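(* Let $\Sigma$ and $\Gamma$ be two finite alphabets, each with at least two letters, and let $f: \Sigma^\omega \to \Gamma^\omega$ be an $\omega$-rational function. Then there is a dense subset $G$ of $\Sigma^\omega$ which is a regular $\omega$-language and a $\mathbf{\Pi}^0_2$-subset of $\Sigma^\omega$, such that the restriction of $f$ to $G$ is continuous. Moreover one can construct, from a $2$-tape Büchi automaton accepting the graph of the function $f$, a deterministic Büchi automaton accepting a dense $\mathbf{\Pi}^0_2$-subset $G$ of $\Sigma^\omega$ such that the restriction of $f$ to $G$ is continuous (i.e. there is an algorithm which, given any such $2$-tape Büchi automaton, outputs such a deterministic Büchi automaton).
   Context: For a finite alphabet $X$, $X^\star$ is the set of finite words over $X$ (including the empty word) and $X^\omega$ is the set of infinite words over $X$, equipped with the product topology of the discrete topology on $X$ (the Cantor topology). A $\mathbf{\Pi}^0_2$-subset is a countable intersection of open sets. The restriction of $f$ to $G$ is continuous with respect to the subspace topology on $G$. A Büchi automaton over $\Sigma$ is a tuple $(K,\Sigma,\delta,q_0,F)$ with $K$ a finite set of states, $q_0\in K$, $\delta: K\times\Sigma\to 2^K$ and $F\subseteq K$; it is deterministic if $\delta: K\times\Sigma\to K$. A run on $\sigma=a_1a_2\ldots\in\Sigma^\omega$ is a sequence of states $q_1q_2\ldots$ whose first term $q_1$ is the initial state and with $q_{i+1}\in\delta(q_i,a_i)$ (in the deterministic case $q_{i+1}=\delta(q_i,a_i)$) for all $i\ge1$. The automaton accepts $\sigma$ iff there is a run on $\sigma$ in which some state of $F$ occurs infinitely often; the $\omega$-language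 accepted by the automaton is the set of all accepted $\sigma\in\Sigma^\omega$. An $\omega$-language is regular iff it is accepted by some (possibly nondeterministic) Büchi automaton. A $2$-tape Büchi automaton is a sextuple $\mathcal{T}=(K,\Sigma,\Gamma,\Delta,q_0,F)$, where $K$ is a finite set of states, $\Sigma$ and $\Gamma$ are finite alphabets (input and output), $\Delta$ is a finite subset of $K\times\Sigma^\star\times\Gamma^\star\times K$ (the transitions), $q_0\in K$ is the initial state, and $F\subseteq K$ is the set of accepting states. A computation is an infinite sequence of consecutive transitions $(q_0,u_1,v_1,q_1),(q_1,u_2,v_2,q_2),\ldots$ from $\Delta$ starting in the initial state; it is successful iff some state of $F$ equals $q_i$ for infinitely many $i$. Its input word is $u_1u_2u_3\cdots$ and its output word is $v_1v_2v_3\cdots$ (each may be finite or infinite). The relation accepted by $\mathcal{T}$ is the set $R(\mathcal{T})\subseteq\Sigma^\omega\times\Gamma^\omega$ of pairs $(u,v)$ of infinite words such that $u$ and $v$ are the input and output words of some successful computation of $\mathcal{T}$. A function $f:\Sigma^\omega\to\Gamma^\omega$ is $\omega$-rational if its graph equals $R(\mathcal{T})$ for some $2$-tape Büchi automaton $\mathcal{T}$. *)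

(* Defs.v *)
From HB Require Import structures.
From mathcomp Require Import all_boot finmap.
From mathcomp Require Import boolp classical_sets topology borel_hierarchy.

Set Implicit Arguments.
Unset Strict Implicit.
Unset Printing Implicit Defensive.

Local Open Scope fset_scope.
Local Open Scope classical_set_scope.

(* X^omega with the Cantor topology; the i-th letter is [w i], from i = 0. *)
Definition omega (X : finType) : Type :=
  prod_topology (fun _ : nat => discrete_topology X).

HB.instance Definition _ (X : finType) := Topological.on (omega X).

Definition inf_often (K : finType) (F : {set K}) (r : nat -> K) : Prop :=
  exists2 q, q \in F & forall N, exists2 i, N <= i & r i = q.

Record buchi (X : finType) := Buchi {
  b_state : finType;
  b_trans : b_state -> X -> {set b_state};
  b_init : b_state;
  b_acc : {set b_state} }.

Definition buchi_lang (X : finType) (A : buchi X) : set (omega X) :=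
  [set w | exists r : nat -> b_state A,
    [/\ r 0 = b_init A,
        forall i, r i.+1 \in b_trans (r i) (w i)
      & inf_often (b_acc A) r]].

Definition omega_regular (X : finType) (L : set (omega X)) : Prop :=
  exists A : buchi X, L = buchi_lang A.

Record dbuchi (X : finType) := DBuchi {
  d_state : finType;
  d_trans : d_state -> X -> d_state;
  d_init : d_state;
  d_acc : {set d_state} }.

Definition dbuchi_lang (X : finType) (A : dbuchi X) : set (omega X) :=
  [set w | exists r : nat -> d_state A,
    [/\ r 0 = d_init A,
        forall i, r i.+1 = d_trans (r i) (w i)
      & inf_often (d_acc A) r]].

Record buchi2 (X Y : finType) := Buchi2 {
  t_state : finType;
  t_trans : {fset t_state * seq X * seq Y * t_state};
  t_init : t_state;
  t_acc : {set t_state} }.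

Definition src (K X Y : Type) (t : K * X * Y * K) : K := t.1.1.1.
Definition inp (K X Y : Type) (t : K * X * Y * K) : X := t.1.1.2.
Definition out (K X Y : Type) (t : K * X * Y * K) : Y := t.1.2.
Definition tgt (K X Y : Type) (t : K * X * Y * K) : K := t.2.

(* The infinite concatenation u_0 u_1 u_2 ... is infinite and equal to w:
   all finite concatenations are prefixes of w, and their lengths are
   unbounded. *)
Definition concat_is (X : finType) (u : nat -> seq X) (w : omega X) : Prop :=
  let p n := flatten (mkseq u n) in
  (forall n, p n = mkseq w (size (p n))) /\ (forall N, exists n, N <= size (p n)).

Definition computation (X Y : finType) (T : buchi2 X Y)
    (c : nat -> t_state T * seq X * seq Y * t_state T) : Prop :=
  [/\ src (c 0) = t_init T,
      forall i, c i \in t_trans T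
    & forall i, tgt (c i) = src (c i.+1)].

Definition buchi2_rel (X Y : finType) (T : buchi2 X Y) :
    set (omega X * omega Y) :=
  [set uv | exists c,
    [/\ computation (T := T) c,
        inf_often (t_acc T) (fun i => src (c i)),
        concat_is (fun i => inp (c i)) uv.1
      & concat_is (fun i => out (c i)) uv.2]].

Definition fun_graph (S T : Type) (f : S -> T) : set (S * T) :=
  [set uv | uv.2 = f uv.1].

Definition omega_rational (X Y : finType) (f : omega X -> omega Y) : Prop :=
  exists T : buchi2 X Y, fun_graph f = buchi2_rel T.

(* Algorithms are mu-recursive functions on natural numbers. *)
Inductive recfun : Type :=
  | RZero
  | RSucc
  | RProj of nat
  | RComp of recfun & seq recfun
  | RPrec of recfun & recfun
  | RMin of recfun.

(* [computes p xs y]: the partial function denoted by p is defined on the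
   arguments xs, with value y. *)
Fixpoint computes (p : recfun) (xs : seq nat) (y : nat) {struct p} : Prop :=
  match p with
  | RZero => y = 0
  | RSucc => exists2 x, xs = [:: x] & y = x.+1
  | RProj i => i < size xs /\ y = nth 0 xs i
  | RComp f gs =>
      exists2 ys,
        (fix all_compute (gs : seq recfun) (ys : seq nat) {struct gs} : Prop :=
           match gs, ys with
           | [::], [::] => True
           | g :: gs', z :: ys' => computes g xs z /\ all_compute gs' ys'
           | _, _ => False
           end) gs ys
        & computes f ys y
  | RPrec f g =>
      exists n xs', xs = n :: xs' /\
        (fix rec (n : nat) (y : nat) {struct n} : Prop :=
           match n with
           | 0 => computes f xs' y
           | m.+1 => exists2 z, rec m z & computes g (m :: z :: xs') y
           end) n y
  | RMin f =>
      computes f (y :: xs) 0 /\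
      forall m, m < y -> exists k, computes f (m :: xs) k.+1
  end.

(* States and letters are numbered by their rank in the enumeration of their
   type; CodeSeq.code is an effective bijection from seq nat to nat. *)
Definition rk (K : finType) (q : K) : nat := enum_rank q.

Definition code_word (X : finType) (u : seq X) : nat :=
  CodeSeq.code (map (@rk X) u).

Definition code_states (K : finType) (F : {set K}) : nat :=
  CodeSeq.code (map (@rk K) (enum F)).

Definition code_buchi2 (X Y : finType) (T : buchi2 X Y) : nat :=
  CodeSeq.code [:: #|t_state T|; #|X|; #|Y|;
    CodeSeq.code [seq CodeSeq.code [:: rk (src t); code_word (inp t);
                                       code_word (out t); rk (tgt t)]
                 | t <- enum_fset (t_trans T)];
    rk (t_init T); code_states (t_acc T)].

Definition code_dbuchi (X : finType) (A : dbuchi X) : nat :=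
  CodeSeq.code [:: #|d_state A|; #|X|;
    CodeSeq.code [seq rk (d_trans q a) | q <- enum (d_state A), a <- enum X];
    rk (d_init A); code_states (d_acc A)].

(* Main.v *)
Require Import Defs.
From mathcomp Require Import all_boot finmap boolp classical_sets topology borel_hierarchy zify.
Set Implicit Arguments.
Unset Strict Implicit.
Unset Printing Implicit Defensive.

(* Reading a word u induces a finite relation phi(u) between configurations of
   the transducer, labelled by the states visited and by whether output was
   produced; phi is a morphism into a finite semigroup. Choose z such that
   e = phi(z) is idempotent and the elements e phi(u) e form a group. If z occurs
   infinitely often in a word w starting with uz, every factor between
   occurrences of z acts as a group element, and whether w is accepted from a
   given state depends only on uz. Hence f is continuous on the set of words
   containing z infinitely often: once a computation has produced n output
   letters, one further occurrence of z guarantees that it can be continued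
   successfully.
   For effectiveness no search for z is needed: z has length at most the size N
   of the semigroup, so it is a factor of the concatenation of all words of
   length N, and the automaton waiting for this concatenation infinitely often is
   given by an explicit primitive recursive formula in the code of T. *)

(** * Finite semigroups *)

Section FiniteSemigroup.
Variables (S : finType) (op : S -> S -> S).
Hypothesis opA : associative op.
Local Infix "**" := op (at level 40, left associativity).

(* [pw a n] is the power of exponent [n + 1]. *)
Definition pw (a : S) (n : nat) : S := iter n (op a) a.

Lemma pwS a n : pw a n.+1 = a ** pw a n.
Proof. by []. Qed.

Lemma pwD a m n : pw a m ** pw a n = pw a (m + n).+1.
Proof. by elim: m => [|m IH] //; rewrite !pwS -opA IH. Qed.

Lemma nat_collision (T : finType) (g : nat -> T) :
  exists i j, [/\ i < j, j <= #|T| & g i = g j].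
Proof.
pose h (i : 'I_#|T|.+1) := g i.
have : ~~ injectiveb h.
  apply/negP => /injectiveP /leq_card; by rewrite card_ord ltnn.
case/injectivePn => x [y nxy hxy].
case: (ltngtP x y) => xy.
- by exists x, y; split=> //; rewrite -ltnS ltn_ord.
- by exists y, x; split=> //; rewrite -ltnS ltn_ord.
- by case/eqP: nxy; apply: val_inj.
Qed.

(** Powers of [a] have period [p] from index [i] on. The witness has exponent [i.+1 * p], a multiple
    of the period past the preperiod, so squaring changes nothing. *)
Lemma idempotent_power a : exists n, pw a n ** pw a n = pw a n.
Proof.
have [i [j [ij _ eij]]] := nat_collision (pw a).
pose p := j - i.
have per m : i <= m -> pw a (m + p) = pw a m.
  move=> im; case: (ltngtP i m) im => // [im _|<- _]; last first.
    by rewrite /p subnKC ?(ltnW ij).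
  have -> : m + p = (j + (m - i.+1)).+1 by rewrite /p; lia.
  by rewrite -pwD -eij pwD; congr pw; lia.
have pert m t : i <= m -> pw a (m + t * p) = pw a m.
  move=> im; elim: t => [|t IH]; first by rewrite addn0.
  by rewrite mulSnr addnA per ?IH //; lia.
exists (i.+1 * p).-1; rewrite pwD.
have p0 : 0 < p by rewrite subn_gt0.
have -> : ((i.+1 * p).-1 + (i.+1 * p).-1).+1 = (i.+1 * p).-1 + i.+1 * p by nia.
by apply: pert; nia.
Qed.

Variable P : {set S}.
Hypothesis PM : forall a b, a \in P -> b \in P -> a ** b \in P.

Lemma pw_in a n : a \in P -> pw a n \in P.
Proof. by move=> aP; elim: n => [|n IH] //; rewrite pwS PM. Qed.

Definition corner (e : S) : {set S} := [set e ** x ** e | x in P]%SET.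

(* An idempotent whose corner [e P e] has the least cardinality lies in the
   minimal ideal, so its corner is a finite group. *)
Lemma group_idempotent a : a \in P ->
  exists e, [/\ e \in P, e ** e = e &
    forall m, m \in P -> exists n, pw (e ** m ** e) n.+1 = e].
Proof.
move=> aP; have [n0 an0] := idempotent_power a.
pose id0 := [pred e | (e \in P) && (e ** e == e)].
have id0a : id0 (pw a n0) by rewrite /= pw_in //= an0.
case: (arg_minnP (fun e => #|corner e|) id0a) => e /andP[eP /eqP ee] emin.
exists e; split=> // m mP.
set k := e ** m ** e.
have kP : k \in P by rewrite !PM.
have [n idn] := idempotent_power k; set f := pw k n in idn.
have fP : f \in P by apply: pw_in.
have ek : e ** k = k by rewrite /k !opA ee.
have ke : k ** e = k by rewrite /k -opA ee.
have pwE n' : e ** pw k n' = pw k n' /\ pw k n' ** e = pw k n'.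
  elim: n' => [|n' [_ IH]]; first by rewrite /pw /= ek ke.
  by rewrite !pwS opA ek -opA IH.
have [ef fe] : e ** f = f /\ f ** e = f by apply: pwE.
have sub : corner f \subset corner e.
  apply/fintype.subsetP => y /imsetP[x xP ->]; apply/imsetP; exists (f ** x ** f).
    by rewrite !PM.
  by rewrite !opA ef -(opA (f ** x)) fe.
have eqc : corner f = corner e.
  apply/eqP; rewrite eqEcard sub emin //=; by rewrite fP /= idn.
(* Since [e = e ** e ** e] lies in its own corner, it has the form [f ** x ** f], whence
   [e ** f = e]; but also [e ** f = f]. *)
have : e \in corner f.
  by rewrite eqc; apply/imsetP; exists e => //; rewrite !ee.
case/imsetP => x xP ex.
have eqf : f = e by rewrite -ef ex -!opA idn.
(* Squaring the idempotent power [pw k n] gives an index of the required form [n.+1]. *)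
exists (n + n); by rewrite -pwD idn.
Qed.

End FiniteSemigroup.

Section ShortWords.
Variables (X S : finType) (op : S -> S -> S) (phi : seq X -> S).
Hypothesis phi_cat : forall u v, phi (u ++ v) = op (phi u) (phi v).

(** Pumping: in a longer word two prefixes have the same image, and the factor between them can be
    cut out. *)
Lemma short_word u : exists2 v, size v <= #|S| & phi v = phi u.
Proof.
have [n] := ubnP (size u); elim: n u => // n IH u un.
have [su|su] := leqP (size u) #|S|; first by exists u.
have [i [j [ij jS eij]]] := nat_collision (fun i => phi (take i u)).
have [v vS ev] : exists2 v, size v <= #|S| & phi v = phi (take i u ++ drop j u).
  by apply: IH; rewrite size_cat size_take size_drop; case: ifP; lia.
by exists v => //; rewrite ev phi_cat eij -phi_cat cat_take_drop.
Qed.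

(** The second clause says that the elements [e ** phi u ** e], with [e = phi z], form a group. The
    power has exponent at least 2, so that removing one factor leaves an inverse. *)
Definition group_word (z : seq X) : Prop :=
  op (phi z) (phi z) = phi z /\
  forall u, exists n, pw op (op (op (phi z) (phi u)) (phi z)) n.+1 = phi z.

End ShortWords.

(** * Labelled relations along infinite words *)

Section Segments.
Variable X : Type.
Implicit Types (w x : nat -> X) (z : seq X).

Definition seg w n k := mkseq (fun i => w (n + i)) k.
Definition occ z w n := seg w n (size z) = z.
Definition inf_occ z w := forall N, exists2 n, N <= n & occ z w n.

Lemma size_seg w n k : size (seg w n k) = k.
Proof. exact: size_mkseq. Qed.

Lemma seg_cat w n k1 k2 : seg w n (k1 + k2) = seg w n k1 ++ seg w (n + k1) k2.
Proof.
rewrite /seg /mkseq iotaD map_cat add0n; congr (_ ++ _).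
rewrite -{1}[k1]addn0 iotaDl -map_comp; apply: eq_map => i /=.
by rewrite addnA.
Qed.

Lemma eq_seg w x n k : (forall i, n <= i < n + k -> w i = x i) -> seg w n k = seg x n k.
Proof.
move=> h; rewrite /seg /mkseq; apply/eq_in_map => i.
by rewrite mem_iota => /andP[_ ik]; apply: h; lia.
Qed.

Lemma occ_seg z w n k : occ z w n -> size z <= k ->
  exists y, seg w n k = z ++ y.
Proof.
by move=> zn zk; exists (seg w (n + size z) (k - size z)); rewrite -{1}zn -seg_cat subnKC.
Qed.

End Segments.

Definition infinite (Q : nat -> Prop) := forall N, exists2 n, N <= n & Q n.

Lemma infinite_pigeonhole (F : finType) (Q : nat -> Prop) (g : nat -> F) :
  infinite Q -> exists v, infinite (fun n => Q n /\ g n = v).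
Proof.
move=> Qinf; apply: contrapT => /forallNP nv.
have {}nv v : exists N, forall n, N <= n -> Q n -> g n <> v.
  move: (nv v) => /existsNP[N hN]; exists N => n Nn Qn gn.
  by apply: hN; exists n.
have [b hb] := choice nv.
have [n hn Qn] := Qinf (\max_v b v).
by apply: (hb (g n) n) => //; apply: leq_trans hn; apply: leq_bigmax.
Qed.

(** Collects all the labels of [J] in one finite stretch, which can then be made into a single
    loop. *)
Lemma infinite_window (I : finType) (J : {set I}) (l : nat -> {set I}) :
  (forall j, j \in J -> infinite (fun n => j \in l n)) ->
  forall n, exists m, forall j, j \in J -> exists2 i, n <= i < m & j \in l i.
Proof.
move=> Jinf n.
have : forall j, exists i, j \in J -> n <= i /\ j \in l i.
  move=> j; case: (boolP (j \in J)) => jJ; last by exists 0.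
  by have [i ni ji] := Jinf j jJ n; exists i.
case/choice => b hb; exists (\max_j b j).+1 => j jJ.
have [nb jb] := hb j jJ; exists (b j) => //.
by rewrite nb ltnS leq_bigmax.
Qed.

Section LabelledRelations.
Variables (C I : finType).
Local Notation lrel := {set C * {set I} * C}.
Implicit Types (R : lrel) (p q : C).

Definition lcomp R1 R2 : lrel :=
  [set x | [exists r, exists l1, exists l2,
     [&& (x.1.1, l1, r) \in R1, (r, l2, x.2) \in R2 & x.1.2 == l1 :|: l2]]]%SET.

Local Infix "**" := lcomp (at level 40, left associativity).

Lemma lcompP R1 R2 p l q :
  (p, l, q) \in R1 ** R2 <->
  exists r l1 l2, [/\ (p, l1, r) \in R1, (r, l2, q) \in R2 & l = (l1 :|: l2)%SET].
Proof.
rewrite inE /=; split.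
  by case/existsP => r /existsP[l1 /existsP[l2 /and3P[h1 h2 /eqP h3]]]; exists r, l1, l2.
case=> r [l1 [l2 [h1 h2 h3]]]; apply/existsP; exists r; apply/existsP; exists l1.
by apply/existsP; exists l2; rewrite h1 h2 h3 eqxx.
Qed.

Lemma lcomp_in R1 R2 p l1 r l2 q :
  (p, l1, r) \in R1 -> (r, l2, q) \in R2 -> (p, (l1 :|: l2)%SET, q) \in R1 ** R2.
Proof. by move=> h1 h2; apply/lcompP; exists r, l1, l2. Qed.

Lemma lcompA : associative lcomp.
Proof.
move=> R1 R2 R3; apply/setP => -[[p l] q]; apply/idP/idP => /lcompP.
  case=> r [l1 [l2 [h1 /lcompP[r' [l3 [l4 [h3 h4 ->]]]] ->]]].
  by rewrite finset.setUA; apply: lcomp_in h4; apply: lcomp_in h3.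
case=> r [l1 [l2 [/lcompP[r' [l3 [l4 [h3 h4 ->]]]] h2 ->]]].
by rewrite -finset.setUA; apply: lcomp_in h3 _; apply: lcomp_in h2.
Qed.

Lemma pw_loop R p l n : (p, l, p) \in R -> (p, l, p) \in pw lcomp R n.
Proof.
by move=> h; elim: n => [|n IH] //; rewrite pwS -(finset.setUid l); apply: lcomp_in h IH.
Qed.

Variables (X : finType) (phi : seq X -> lrel).
Hypothesis phi_cat : forall u v, phi (u ++ v) = phi u ** phi v.

(** A computation yields a [letter_run], which can be cut anywhere. A [block_run] has freely chosen
    cuts, possibly with empty blocks, and is still enough to rebuild a computation. *)
Definition letter_run (w : nat -> X) p (J : {set I}) :=
  exists r l, [/\ r 0 = p, forall i, (r i, l i, r i.+1) \in phi [:: w i]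
    & forall j, j \in J -> infinite (fun i => j \in l i)].

Definition block_run (w : nat -> X) p (J : {set I}) :=
  exists n r l, [/\ n 0 = 0, (forall i, n i <= n i.+1) /\ (forall N, exists i, N <= n i),
    r 0 = p, forall i, (r i, l i, r i.+1) \in phi (seg w (n i) (n i.+1 - n i))
    & forall j, j \in J -> infinite (fun i => j \in l i)].

(** Only nonempty factors are treated, since nothing is assumed here about the image of the empty
    word. *)
Lemma letter_seg (w : nat -> X) r l : (forall i, (r i, l i, r i.+1) \in phi [:: w i]) ->
  forall n k, exists2 m, (r n, m, r (n + k.+1)) \in phi (seg w n k.+1)
    & forall i, n <= i < n + k.+1 -> l i \subset m.
Proof.
move=> h n; elim=> [|k [m IH1 IH2]].
  exists (l n); first by rewrite addn1 /seg /mkseq /= addn0.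
  by move=> i ?; have -> : i = n by lia.
exists (m :|: l (n + k.+1))%SET.
  rewrite -[k.+2]addn1 seg_cat phi_cat; apply: lcomp_in IH1 _.
  by rewrite addnA addn1 /seg /mkseq /= addn0.
move=> i hi; case: (ltngtP i (n + k.+1)) => hik; last 1 first.
- by rewrite hik finset.subsetUr.
- by apply: (fintype.subset_trans (IH2 i _)); [lia | exact: finset.subsetUl].
- by lia.
Qed.

Variable z : seq X.
Local Notation e := (phi z).
Hypothesis zgroup : group_word lcomp phi z.
Let ee : e ** e = e := zgroup.1.
Let group_e : forall u, exists n, pw lcomp (e ** phi u ** e) n.+1 = e := zgroup.2.

(** If the power of [g] of index [n.+1] is [e], the one of index [n] is a two-sided inverse. *)
Lemma corner_inverse u : let g := e ** phi u ** e in
  exists i, i ** g = e /\ g ** i = e.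
Proof.
move=> g; have [n gn] := group_e u; exists (pw lcomp g n); split.
  by rewrite -gn -[g in LHS]/(pw lcomp g 0) pwD ?addn0 //; exact: lcompA.
by rewrite -gn pwS.
Qed.

(* A configuration repeated at occurrences of z loops on some h = e phi(v1),
   and a power of h e is e: the loop moves to one of e itself. *)
Lemma letter_run_loop (w : nat -> X) p J a : inf_occ z w -> occ z w a -> letter_run w p J ->
  exists v l L y, [/\ (p, l, y) \in phi (seg w 0 a) ** (e ** phi v ** e),
    (y, L, y) \in e & J \subset L].
Proof.
move=> wz wa [r [lab [r0 rlab labJ]]].
(* Some configuration [q] recurs at occurrences of [z]. The positions [n0 < n1] are chosen so far
   apart that the loop from [q] to [q] collects all of [J] and begins with a full copy of [z]. *)
have [q qinf] := infinite_pigeonhole r wz.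
have [n0 n0a [n0z rn0]] := qinf (a + size z).+1.
have [N hN] := infinite_window labJ n0.
have [n1 n1N [n1z rn1]] := qinf (maxn N (n0 + size z).+1).
have [l0 hl0 _] := letter_seg rlab 0 n0.-1.
have [l1 hl1 hl1s] := letter_seg rlab n0 (n1 - n0).-1.
have e1 : (n1 - n0).-1.+1 = n1 - n0 by lia.
have e0 : n0.-1.+1 = n0 by lia.
rewrite e1 subnKC in hl1 hl1s; last by lia.
rewrite e0 add0n in hl0.
have [v1 ev1] : exists y, seg w n0 (n1 - n0) = z ++ y by apply: occ_seg => //; lia.
pose v0 := seg w (a + size z) (n0 - (a + size z)).
have ev0 : seg w 0 n0 = seg w 0 a ++ z ++ v0.
  have {1}-> : n0 = a + (size z + (n0 - (a + size z))) by lia.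
  by rewrite seg_cat add0n seg_cat wa.
rewrite rn1 rn0 ev1 phi_cat in hl1.
rewrite r0 rn0 ev0 !phi_cat in hl0.
set h := e ** phi v1 in hl1.
have eh : e ** h = h by rewrite /h lcompA ee.
have [n hn] := group_e v1; rewrite -/h in hn.
have ehn m : e ** pw lcomp h m = pw lcomp h m.
  by case: m => [|m]; [exact: eh | rewrite pwS lcompA eh].
have hne m : pw lcomp (h ** e) m = pw lcomp h m ** e.
  elim: m => [|m IH] //; by rewrite !pwS IH -lcompA (lcompA e) ehn lcompA.
(* Cut the iterated loop after a leading [e], at [y]. Going round from [y] reads a power of [h]
   followed by [e], that is a power of [h ** e], which is [e]. *)
have := pw_loop n.+1 hl1; rewrite -ehn.
case/lcompP => y [l2 [l3 [h2 h3 el]]].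
exists v0, (l0 :|: l2)%SET, l1, y; split.
- by rewrite !lcompA; apply: lcomp_in h2; rewrite -!lcompA.
- by rewrite el finset.setUC -hn hne; apply: lcomp_in h3 h2.
- apply/fintype.subsetP => j jJ; have [i hi ji] := hN j jJ.
  have /fintype.subsetP := hl1s i ltac:(lia); exact.
Qed.

(* By the group property the prefix of x before an occurrence of z reaches, up
   to e, a state with a loop on e, and pigeonhole makes the blocks m between
   suitable occurrences satisfy m e = e. Moving each e one block later turns the
   loop on the e = m e into a run through the blocks m. *)
Lemma loop_block_run (x : nat -> X) p (J : {set I}) a v l L y : inf_occ z x -> occ z x a ->
    (p, l, y) \in phi (seg x 0 a) ** (e ** phi v ** e) ->
    (y, L, y) \in e -> J \subset L ->
  block_run x p J.
Proof.
move=> xz xa hp hy JL.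
(* All cuts [n i] are occurrences of [z] at which the factor of [x] read since [a] has the same
   image [g']. *)
have [g' ginf] := infinite_pigeonhole (fun n => phi (seg x a (n - a))) xz.
have : forall N, exists n, N <= n /\ (occ z x n /\ phi (seg x a (n - a)) = g').
  by move=> N; have [n] := ginf N; exists n.
case/choice => nxt hnxt.
pose n i := iter i (fun m => nxt (m + size z).+1) (nxt (a + size z)).
have nz i : occ z x (n i) by case: i => [|i]; apply: (hnxt _).2.1.
have ng i : phi (seg x a (n i - a)) = g' by case: i => [|i]; apply: (hnxt _).2.2.
have nS i : n i + size z < n i.+1 by apply: (hnxt _).1.
have n0 : a + size z <= n 0 by apply: (hnxt _).1.
clearbody n.
have n0E : n 0 = a + (n 0 - a) by lia.
have [y0 ey0] : exists y0, seg x a (n 0 - a) = z ++ y0 by apply: occ_seg; [|lia].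
have g'E : g' = e ** phi y0 by rewrite -(ng 0) ey0 phi_cat.
have [gi [gig ggi]] := corner_inverse y0.
have [g0i [g0ig g0gi]] := corner_inverse v.
set g0 := e ** phi v ** e in hp g0ig g0gi.
set g := e ** phi y0 ** e in gig ggi.
have eg0 : e ** g0 = g0 by rewrite /g0 !lcompA ee.
have eg : e ** g = g by rewrite /g !lcompA ee.
have gE : g = g' ** e by rewrite g'E.
(* The group elements [c] and [c'] are mutually inverse. Splitting the loop at [y] along
   [e = c' ** c] and swapping the halves gives a loop at [p3], which is reached through
   [g0 ** c' = g] instead of [g0]. *)
pose c := gi ** g0; pose c' := g0i ** g.
have c'c : c' ** c = e by rewrite /c /c' lcompA -(lcompA g0i) ggi -lcompA eg0 g0ig.
have cc' : c ** c' = e by rewrite /c /c' lcompA -(lcompA gi) g0gi -lcompA eg gig.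
have g0c' : g0 ** c' = g by rewrite /c' lcompA g0gi eg.
move: (hy); rewrite -[in X in X -> _]c'c => /lcompP[p3 [l1 [l2 [h1 h2 eL]]]].
have h3 : (p3, L, p3) \in e by rewrite eL finset.setUC -cc'; apply: lcomp_in h2 h1.
have : (p, (l :|: l1)%SET, p3) \in phi (seg x 0 a) ** g' ** e.
  by rewrite -lcompA -gE -g0c' lcompA; apply: lcomp_in hp h1.
case/lcompP => r0 [l3 [l4 [h4 h5 _]]].
pose m i := phi (seg x (n i) (n i.+1 - n i)).
have em i : e ** m i = m i.
  have [yi eyi] : exists yi, seg x (n i) (n i.+1 - n i) = z ++ yi.
    by apply: occ_seg => //; have := nS i; lia.
  by rewrite /m eyi phi_cat lcompA ee.
have nge i : a <= n i by elim: i => [|i]; [lia | have := nS i; lia].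
have g'm i : g' ** m i = g'.
  have := ng i.+1.
  have -> : n i.+1 - a = (n i - a) + (n i.+1 - n i) by have := nS i; have := nge i; lia.
  by rewrite seg_cat phi_cat ng subnKC.
(* Appending the block leaves [g'] unchanged, so the inverse [gi] cancels the prefix. *)
have me i : m i ** e = e.
  have gm : g ** m i = g' by rewrite gE -lcompA em g'm.
  have : gi ** (g ** m i) ** e = e by rewrite gm -lcompA -gE gig.
  by rewrite lcompA gig em.
have : forall i, exists sab : C * {set I} * {set I},
    [/\ (p3, sab.1.2, sab.1.1) \in m i, (sab.1.1, sab.2, p3) \in e
      & J \subset sab.1.2 :|: sab.2]%SET.
  move=> i; move: h3; rewrite -[in X in X -> _](me i).
  by case/lcompP => s [A [B' [h6 h7 eL']]]; exists (s, A, B'); rewrite -eL'.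
case/choice => sab hsab.
(* The run is at [r0] at cut [n 0] and at the state of [sab i] at cut [n i.+1]. Each step first
   takes an [e] to [p3] and then the block, which absorbs that [e] by [em]. *)
exists (fun i => if i is i'.+1 then n i' else 0).
exists (fun i => if i is i'.+1 then (if i' is i''.+1 then (sab i'').1.1 else r0) else p).
exists (fun i => if i is i'.+1 then
   (if i' is i''.+1 then (sab i'').2 else l4) :|: (sab i').1.2 else l3)%SET.
split=> //.
- split=> [[|i] //|N]; first by have := nS i; lia.
  exists N.+1; elim: N => [|N IH] //; by have := nS N; lia.
- move=> [|[|i]] /=.
  + by rewrite subn0 n0E seg_cat add0n phi_cat ng.
  + by rewrite -/(m 0) -em; apply: lcomp_in h5 _; have [] := hsab 0.
  + rewrite -/(m i.+1) -em; have [_ h6 _] := hsab i; apply: lcomp_in h6 _.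
    by have [] := hsab i.+1.
move=> j jJ N.
(* The two halves of the label of the loop number [N] fall into the blocks [N.+1] and [N.+2]. *)
have [_ _ /fintype.subsetP/(_ j jJ)] := hsab N.
rewrite finset.in_setU => /orP[] hj; [exists N.+1 | exists N.+2];
  by rewrite /= ?finset.in_setU ?hj ?orbT //; lia.
Qed.

End LabelledRelations.

(** * Transducers *)

Section Concatenation.
Variables (A : Type) (b : nat -> seq A).
Local Notation F n := (flatten (mkseq b n)).

Lemma flatten_mkseqS n : F n.+1 = F n ++ b n.
Proof. by rewrite mkseqS flatten_rcons. Qed.

Lemma flatten_mkseqD n k : exists s, F (n + k) = F n ++ s.
Proof.
elim: k => [|k [s IH]]; first by exists [::]; rewrite addn0 cats0.
by exists (s ++ b (n + k)); rewrite addnS flatten_mkseqS IH catA.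
Qed.

Lemma leq_size_flatten m n : m <= n -> size (F m) <= size (F n).
Proof.
by move=> /subnKC <-; have [s ->] := flatten_mkseqD m (n - m); rewrite size_cat leq_addr.
Qed.

Lemma nth_flatten_mkseq d m n j : j < size (F m) -> j < size (F n) ->
  nth d (F m) j = nth d (F n) j.
Proof.
wlog mn : m n / m <= n.
  move=> h jm jn; case: (leqP m n) => mn; first exact: h.
  by symmetry; apply: h => //; apply: ltnW.
by case/subnKC: mn => <- jm; have [s ->] := flatten_mkseqD m (n - m); rewrite nth_cat jm.
Qed.

Lemma infinite_concat : (forall N, exists n, N <= size (F n)) ->
  exists c : nat -> A, forall n, F n = mkseq c (size (F n)).
Proof.
move=> unb.
have [d _] : exists d : A, True.
  by have {unb} [n] := unb 1; case: (F n) => [|a s _] //; exists a.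
have [k hk] := choice (fun j => unb j.+1).
exists (fun j => nth d (F (k j)) j) => n.
apply: (@eq_from_nth _ d); first by rewrite size_mkseq.
by move=> j jn; rewrite nth_mkseq //; apply: nth_flatten_mkseq.
Qed.

End Concatenation.

Section Transducer.
Variables (X Y : finType) (T : buchi2 X Y) (B : nat).
Local Notation K := (t_state T).
Local Notation tr := (K * seq X * seq Y * K)%type.
Hypothesis inp_le : forall t : tr, t \in t_trans T -> size (inp t) <= B.

Fixpoint tpath (p : K) (ts : seq tr) (q : K) : Prop :=
  if ts is t :: ts' then [/\ t \in t_trans T, src t = p & tpath (tgt t) ts' q]
  else p = q.

Lemma tpath_cat p s1 s2 q :
  tpath p (s1 ++ s2) q <-> exists2 r, tpath p s1 r & tpath r s2 q.
Proof.
elim: s1 p => [|t s1 IH] p /=; first by split=> [h|[r -> //]]; exists p.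
split=> [[h1 h2 /IH[r h3 h4]]|[r [h1 h2 h3] h4]]; first by exists r.
by split=> //; apply/IH; exists r.
Qed.

Lemma tpath_inj p s q q' : tpath p s q -> tpath p s q' -> q = q'.
Proof.
elim: s p => [|t s IH] p /=; first by move=> <-.
by case=> _ _ h [_ _ /(IH _ h)].
Qed.

Definition input (ts : seq tr) : seq X := flatten [seq inp t | t <- ts].

Lemma input_cat s1 s2 : input (s1 ++ s2) = input s1 ++ input s2.
Proof. by rewrite /input map_cat flatten_cat. Qed.

Lemma input_mkseq (c : nat -> tr) n :
  input (mkseq c n) = flatten (mkseq (fun i => inp (c i)) n).
Proof. by rewrite /input /mkseq -map_comp. Qed.

Lemma size_input p s q : tpath p s q -> size (input s) <= B * size s.
Proof.
elim: s p => [|t s IH] p //= [tT _ /IH h].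
rewrite /input /= size_cat mulnS; apply: leq_add; first exact: inp_le.
exact: h.
Qed.

(* [None] marks the transitions with a nonempty output, [Some q] those which
   leave [q]. *)
Definition flag (t : tr) (i : option K) : bool :=
  if i is Some q then src t == q else out t != [::].

Definition labels (ts : seq tr) : {set option K} := [set i | has (flag^~ i) ts]%SET.

Lemma labels_cat s1 s2 : labels (s1 ++ s2) = (labels s1 :|: labels s2)%SET.
Proof. by apply/setP => i; rewrite finset.in_setU !finset.inE has_cat. Qed.

(* A configuration is a state together with the letters that were already
   consumed beyond the current position. *)
Definition conf : finType := (K * {bseq B of X})%type.

(** The equation balances letters: those read ahead before [u] and those of the path make up [u] and
    the letters read ahead after it. Membership is decided classically; the algorithm uses only the
    cardinality of the type of these relations. *)
Definition phi (u : seq X) : {set conf * {set option K} * conf} :=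
  [set x | `[< exists ts, [/\ tpath x.1.1.1 ts x.2.1, labels ts = x.1.2
     & val x.1.1.2 ++ input ts = u ++ val x.2.2] >]]%SET.

Lemma phiP u (p q : conf) l : (p, l, q) \in phi u <->
  exists ts, [/\ tpath p.1 ts q.1, labels ts = l & val p.2 ++ input ts = u ++ val q.2].
Proof. by rewrite finset.inE /=; split=> /asboolP. Qed.

Lemma tpath_split (s : seq X) p ts q u v : size s <= B -> tpath p ts q ->
  s ++ input ts = u ++ v ->
  exists ts1 ts2 (s1 : {bseq B of X}), ts = ts1 ++ ts2 /\ s ++ input ts1 = u ++ val s1.
Proof.
elim/last_ind: ts q v => [|ts t IH] q v sB.
  rewrite cats0 => _ e.
  have vB : size v <= B by rewrite e size_cat in sB; lia.
  by exists [::], [::], (Bseq vB); split; rewrite // {1}/input /= cats0.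
rewrite -cats1 => /tpath_cat[r h1 /= [tT st _]] e.
have [us|us] := leqP (size u) (size (s ++ input ts)).
  have [v' ev'] : exists v', s ++ input ts = u ++ v'.
    exists (drop (size u) (s ++ input ts)).
    have : take (size u) (s ++ input ts) = u.
      have := congr1 (take (size u)) e.
      by rewrite input_cat catA takel_cat // (take_size_cat v erefl).
    by move=> tu; rewrite -{1}(cat_take_drop (size u) (s ++ input ts)) tu.
  have [ts1 [ts2 [s1 [-> h2]]]] := IH r v' sB h1 ev'.
  by exists ts1, (ts2 ++ [:: t]), s1; rewrite catA.
have vB : size v <= B.
  have := inp_le tT; move: (congr1 size e).
  by rewrite input_cat catA /input /= cats0 -/(input ts) !size_cat in us *; lia.
by exists (ts ++ [:: t]), [::], (Bseq vB); rewrite cats0; split.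
Qed.

(** The overshoot at the border between [u] and [v] is the word stored in the intermediate
    configuration. *)
Lemma phi_cat u v : phi (u ++ v) = lcomp (phi u) (phi v).
Proof.
apply/setP => -[[p l] q]; apply/idP/idP.
  case/phiP => ts [h1 h2]; rewrite -catA => h3.
  have [ts1 [ts2 [s1 [ets h4]]]] := tpath_split (size_bseq _) h1 h3.
  move: h1; rewrite ets => /tpath_cat[r h5 h6].
  rewrite -h2 ets labels_cat; apply: (@lcomp_in _ _ _ _ _ _ (r, s1)).
    by apply/phiP; exists ts1.
  apply/phiP; exists ts2; split=> //=.
  move: h3; rewrite ets input_cat catA h4 -catA => /eqP.
  by rewrite eqseq_cat // eqxx => /eqP.
case/lcompP => r [l1 [l2 [/phiP[s1 [h1 h2 h3]] /phiP[s2 [h4 h5 h6]] ->]]].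
apply/phiP; exists (s1 ++ s2); split.
- by apply/tpath_cat; exists r.1.
- by rewrite labels_cat h2 h5.
- by rewrite input_cat catA h3 -catA h6 catA.
Qed.

(** For [J] consisting of [None] and [Some q'], this asks for infinitely many visits to [q'] and an
    infinite output, whatever that output is. *)
Definition accepts_from (q : K) (w : omega X) (J : {set option K}) : Prop :=
  exists c : nat -> tr,
  [/\ src (c 0) = q, forall i, c i \in t_trans T, forall i, tgt (c i) = src (c i.+1),
      concat_is (fun i => inp (c i)) w
    & forall j, j \in J -> infinite (fun i => flag (c i) j)].

Definition start q : conf := (q, insub_bseq B [::]).

Lemma val_insub_bseq0 : val (insub_bseq B [::] : {bseq B of X}) = [::].
Proof. by rewrite /insub_bseq insubdK. Qed.

Lemma tpath_seg (c : nat -> tr) : (forall i, c i \in t_trans T) ->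
  (forall i, tgt (c i) = src (c i.+1)) ->
  forall a k, tpath (src (c a)) (seg c a k) (src (c (a + k))).
Proof.
move=> cT cc a; elim=> [|k IH]; first by rewrite addn0.
rewrite -addn1 seg_cat; apply/tpath_cat; exists (src (c (a + k))) => //.
by rewrite /seg /mkseq /= addn0 addn1 addnS; split.
Qed.

Lemma step_between (f : nat -> nat) i N M : N <= M -> f N <= i < f M ->
  exists2 n, N <= n & f n <= i < f n.+1.
Proof.
elim: M => [|M IH]; first by rewrite leqn0 => /eqP ->; lia.
rewrite leq_eqVlt => /orP[/eqP <-|NM]; first by lia.
case: (leqP (f M) i) => fM /andP[h1 h2]; first by exists M; rewrite ?fM.
by apply: IH => //; rewrite h1.
Qed.

Lemma accepts_letter_run q w J :
  accepts_from q w J -> letter_run phi w (start q) J.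
Proof.
case=> c [c0 cT cc [cw cinf] cJ].
pose P n := size (flatten (mkseq (fun i => inp (c i)) n)).
have PS n : P n.+1 = P n + size (inp (c n)) by rewrite /P flatten_mkseqS size_cat.
have Pm a b : a <= b -> P a <= P b by apply: leq_size_flatten.
have inputseg a k : input (seg c a k) = seg w (P a) (P (a + k) - P a).
  have h : input (seg c 0 (a + k)) = input (seg c 0 a) ++ input (seg c a k).
    by rewrite seg_cat input_cat.
  have h0 b : input (seg c 0 b) = seg w 0 (P b) by rewrite [LHS]input_mkseq cw.
  have := Pm a (a + k) (leq_addr _ _) => Pak.
  move: h; rewrite !h0 -{1}(subnKC Pak) seg_cat add0n => /eqP.
  by rewrite eqseq_cat // eqxx => /eqP ->.
(* [idx n] is the least number of transitions whose input covers [n] letters. By minimality the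
   excess comes from one transition, so it has at most [B] letters. *)
have : forall n, exists k, n <= P k /\ forall i, n <= P i -> k <= i.
  move=> n; have ex : exists i, n <= P i by exact: cinf.
  by case: (ex_minnP ex) => i h1 h2; exists i.
case/choice => idx hidx.
have idxm n : idx n <= idx n.+1.
  by apply: (hidx n).2; apply: leq_trans (hidx n.+1).1.
have pendB n : size (seg w n (P (idx n) - n)) <= B.
  rewrite size_seg; case E: (idx n) => [|i]; first by rewrite /P /=; lia.
  have : ~~ (n <= P i) by apply/negP => /(hidx n).2; rewrite E ltnn.
  by have := inp_le (cT i); have := PS i; lia.
exists (fun n => (src (c (idx n)), Bseq (pendB n))).
exists (fun n => labels (seg c (idx n) (idx n.+1 - idx n))).
have idx0 : idx 0 = 0 by apply/eqP; rewrite -leqn0; apply: (hidx 0).2.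
split.
- rewrite /start; congr (_, _); first by rewrite idx0.
  by apply: val_inj; rewrite val_insub_bseq0 /= idx0.
- move=> n; apply/phiP; exists (seg c (idx n) (idx n.+1 - idx n)); split=> //=.
    by rewrite -{2}(subnKC (idxm n)); apply: tpath_seg.
  rewrite inputseg subnKC //.
  have h1 := (hidx n).1; have h2 := (hidx n.+1).1; have h3 := Pm _ _ (idxm n).
  have := seg_cat w n (P (idx n) - n) (P (idx n.+1) - P (idx n)); rewrite subnKC // => <-.
  have -> : P (idx n) - n + (P (idx n.+1) - P (idx n)) = 1 + (P (idx n.+1) - n.+1) by lia.
  by rewrite seg_cat addn1 /seg {1}/mkseq /= addn0.
move=> j jJ N.
have [i iN ij] := cJ j jJ (idx N).
(* The first [i] transitions read only [P i] letters, so covering one letter more takes a larger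
   number of them. *)
have big : i < idx (P i).+1.
  rewrite ltnNge; apply/negP => h; have := Pm _ _ h; have := (hidx (P i).+1).1; lia.
have NP : N <= (P i).+1.
  have := (hidx N).1; have := Pm _ _ iN; lia.
have [n Nn /andP[h1 h2]] := step_between NP (introT andP (conj iN big)).
exists n => //; rewrite finset.inE; apply/(has_nthP (c 0)).
exists (i - idx n); first by rewrite size_seg; lia.
by rewrite nth_mkseq ?subnKC //; lia.
Qed.

(** The paths of the blocks are concatenated. The result is infinite because the cuts are unbounded
    while each transition reads at most [B] letters. *)
Lemma block_run_accepts q (w : omega X) J :
  block_run phi w (start q) J -> accepts_from q w J.
Proof.
case=> n [r [l [n0 [nS ninf] r0 hr hJ]]].
have [ts hts] := choice (fun i => (phiP _ _ _ _).1 (hr i)).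
pose F i := flatten (mkseq ts i).
have FS i : F i.+1 = F i ++ ts i by apply: flatten_mkseqS.
have Fpath i : tpath q (F i) (r i).1.
  elim: i => [|i IH]; first by rewrite r0.
  by rewrite FS; apply/tpath_cat; exists (r i).1 => //; have [] := hts i.
have Finput i : input (F i) = seg w 0 (n i) ++ val (r i).2.
  elim: i => [|i IH]; first by rewrite r0 n0 val_insub_bseq0.
  rewrite FS input_cat IH -catA; have [_ _ ->] := hts i.
  by rewrite catA -seg_cat subnKC.
have Finf N : exists i, N <= size (F i).
  have [i hi] := ninf (B * N).+1; exists i.
  have := size_input (Fpath i); rewrite Finput size_cat size_seg.
  move=> h; rewrite leqNgt; apply/negP => h'; nia.
have [c hc] := infinite_concat Finf.
have nm i k : n i <= n (i + k).
  by elim: k => [|k IH]; rewrite ?addn0 // addnS (leq_trans IH).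
have Fm i k : size (F i) <= size (F (i + k)).
  by apply: leq_size_flatten; apply: leq_addr.
have cF k i : k <= size (F i) -> exists s, F i = mkseq c k ++ s.
  move=> ki; exists (seg c k (size (F i) - k)); rewrite [LHS]hc -[mkseq c k]/(seg c 0 k).
  by rewrite -[in RHS](add0n k) -seg_cat /= subnKC.
have cpath k : exists q', tpath q (mkseq c k) q'.
  have [i hi] := Finf k; have [s es] := cF k i hi.
  by have := Fpath i; rewrite es => /tpath_cat[q' h _]; exists q'.
have cst k : tpath q (mkseq c k) (src (c k)) /\ c k \in t_trans T.
  have [q'] := cpath k.+1; rewrite mkseqS -cats1 => /tpath_cat[q1 h1 /= [h2 -> _]].
  by [].
exists c; split.
- by have [/= -> _] := cst 0.
- by move=> i; have [] := cst i.
- move=> i; have [h1 _] := cst i.+1; have [h2 h3] := cst i.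
  apply: tpath_inj h1; rewrite mkseqS -cats1; apply/tpath_cat; exists (src (c i)) => //.
- split=> [k|N].
    set u := flatten _; have eu : u = input (mkseq c k) by rewrite input_mkseq.
    have [i1 hi1] := Finf k; have [i2 hi2] := ninf (size u).
    have hi : k <= size (F (i1 + i2)) by apply: leq_trans hi1 (Fm _ _).
    have hn : size u <= n (i1 + i2) by rewrite addnC; apply: leq_trans hi2 (nm _ _).
    have [s es] := cF k _ hi.
    move: (Finput (i1 + i2)); rewrite es input_cat -eu -(subnKC hn) seg_cat -catA.
    by move=> /eqP; rewrite eqseq_cat ?size_seg // => /andP[/eqP].
  have [i hi] := ninf N; exists (size (F i)).
  by rewrite -input_mkseq -hc Finput size_cat size_seg; lia.
move=> j jJ N.
have [i0 hi0] := Finf N; have [i hi ji] := hJ j jJ i0.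
have [_ el _] := hts i; move: ji; rewrite -el finset.inE => /(has_nthP (c 0))[k hk hf].
have Fi : N <= size (F i) by rewrite -(subnKC hi); apply: leq_trans hi0 (Fm _ _).
exists (size (F i) + k); first by lia.
have : nth (c 0) (F i.+1) (size (F i) + k) = c (size (F i) + k).
  by rewrite [F i.+1]hc nth_mkseq // -/(F i.+1) FS size_cat; lia.
by rewrite FS nth_cat ltnNge leq_addr /= addKn => <-.
Qed.

(** The run on [w] supplies a loop on [phi z] behind the prefix of length [a]. The word [x] shares
    this prefix and the occurrence of [z] after it, so the loop can be unrolled along [x]. *)
Lemma accepts_transfer z q (w x : omega X) J a : group_word (@lcomp _ _) phi z ->
    inf_occ z w -> inf_occ z x -> occ z w a ->
    (forall i, i < a + size z -> w i = x i) ->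
  accepts_from q w J -> accepts_from q x J.
Proof.
move=> zg wz xz wa wx hw; apply: block_run_accepts.
have [v [l [L [y [h1 h2 h3]]]]] := letter_run_loop phi_cat zg wz wa (accepts_letter_run hw).
have e1 : seg w 0 a = seg x 0 a by apply: eq_seg => i ?; apply: wx; lia.
have xa : occ z x a.
  rewrite /occ -[RHS]wa; apply: eq_seg => i ?; rewrite wx //; lia.
by apply: (loop_block_run phi_cat zg xz xa _ h2 h3 (p := start q)); rewrite -e1; exact: h1.
Qed.

Lemma short_group_word : exists2 z,
  size z <= #|{set conf * {set option K} * conf}| & group_word (@lcomp _ _) phi z.
Proof.
pose P := [set R | `[< exists u, phi u = R >]]%SET.
have PP R : R \in P <-> exists u, phi u = R by rewrite finset.inE; split=> /asboolP.
have PM R1 R2 : R1 \in P -> R2 \in P -> lcomp R1 R2 \in P.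
  by case/PP => u <- /PP[v <-]; apply/PP; exists (u ++ v); rewrite phi_cat.
have P1 : phi [::] \in P by apply/PP; exists [::].
have [e [eP ee ge]] := group_idempotent (@lcompA _ _) PM P1.
have [u eu] := (PP e).1 eP.
have [z zs ez] := short_word phi_cat u.
exists z => //; split; rewrite ez eu // => v; apply: ge.
by apply/PP; exists v.
Qed.

End Transducer.

(** * Cantor topology and deterministic automata *)

Section Cylinders.
Variable X : finType.
Implicit Types (w x : omega X) (U : set (omega X)).

Definition cyl w n : set (omega X) := fun x => forall i, i < n -> x i = w i.

Lemma cyl_le w m n : m <= n -> (cyl w n `<=` cyl w m)%classic.
Proof. by move=> mn x h i im; apply: h; apply: leq_trans mn. Qed.

(** The product topology is a supremum of topologies induced by the projections, so convergence of
    the filter of cylinders is checked coordinatewise. *)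
Lemma nbhs_cyl w U : nbhs w U <-> exists n, (cyl w n `<=` U)%classic.
Proof.
split=> [|[n]]; last first.
  move=> /filterS; apply; elim: n => [|n IH]; first by apply: filterS filterT.
  have nw : nbhs w (fun x : omega X => x n = w n).
    have := @proj_continuous nat (fun=> discrete_topology X) n w.
    move/(_ (eq^~ (w n))); apply.
    by rewrite nbhs_principalE.
  apply: filterS (filterI IH nw) => x [h1 h2] i.
  by rewrite ltnS leq_eqVlt => /orP[/eqP ->|/h1].
pose F : set_system (omega X) := fun U => exists n, (cyl w n `<=` U)%classic.
have FF : Filter F.
  split.
  - by exists 0.
  - move=> U1 U2 [m hm] [n hn]; exists (maxn m n) => x hx; split.
      by apply: hm; apply: cyl_le hx; apply: leq_maxl.
    by apply: hn; apply: cyl_le hx; apply: leq_maxr.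
  - by move=> U1 U2 s [m hm]; exists m; apply: classical_sets.subset_trans s.
suff : (F --> w)%classic by apply.
apply/cvg_sup => i V [V' [[W oW <-] Ww] WV].
exists i.+1 => x hx; apply: WV; by rewrite /= /classical_sets.preimage /= hx.
Qed.

Lemma open_cyl U : (forall w, U w -> exists n, (cyl w n `<=` U)%classic) -> open U.
Proof. by rewrite openE => h w /h /nbhs_cyl. Qed.

End Cylinders.

Definition shift (X : finType) (w : omega X) m : omega X := fun i => w (m + i).

Lemma inf_occ_shift (X : finType) z (w : omega X) m :
  inf_occ z w -> inf_occ z (shift w m).
Proof.
move=> wz N; have [n nN zn] := wz (m + N); exists (n - m); first by lia.
rewrite /occ -[RHS]zn /seg; apply/eq_map => i; rewrite /shift; congr w; lia.
Qed.

Section ConcatIs.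
Variable X : finType.
Implicit Types (u : nat -> seq X) (w : omega X).

Lemma flatten_mkseq_add u i k : flatten (mkseq u (i + k)) =
  flatten (mkseq u i) ++ flatten (mkseq (fun j => u (i + j)) k).
Proof. by rewrite -flatten_cat -[mkseq u (i + k)]/(seg u 0 _) seg_cat. Qed.

Lemma mkseq_shift w m k : mkseq w (m + k) = mkseq w m ++ mkseq (shift w m) k.
Proof. by rewrite -[LHS]/(seg w 0 _) seg_cat. Qed.

Lemma concat_is_tail u w i : concat_is u w ->
  concat_is (fun k => u (i + k)) (shift w (size (flatten (mkseq u i)))).
Proof.
move=> [h1 h2]; split=> [k|N].
  have := h1 (i + k); rewrite flatten_mkseq_add size_cat mkseq_shift => /eqP.
  by rewrite eqseq_cat ?size_mkseq // => /andP[_ /eqP].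
have [n hn] := h2 (size (flatten (mkseq u i)) + N); exists (n - i).
have in_ : i <= n \/ n <= i by lia.
case: in_ => h.
  by move: hn; rewrite -{1}(subnKC h) flatten_mkseq_add size_cat leq_add2l.
by have := leq_size_flatten u h; lia.
Qed.

Lemma concat_is_join u w i :
  flatten (mkseq u i) = mkseq w (size (flatten (mkseq u i))) ->
  concat_is (fun k => u (i + k)) (shift w (size (flatten (mkseq u i)))) ->
  concat_is u w.
Proof.
move=> h [h1 h2]; split=> [n|N].
  have [ni|ni] := leqP n i.
    move: h; rewrite -(subnKC ni) flatten_mkseq_add size_cat mkseq_shift => /eqP.
    by rewrite eqseq_cat ?size_mkseq // => /andP[/eqP].
  rewrite -(subnKC (ltnW ni)) flatten_mkseq_add size_cat mkseq_shift -h.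
  by congr (_ ++ _); apply: h1.
by have [n hn] := h2 N; exists (i + n); rewrite flatten_mkseq_add size_cat; lia.
Qed.

Lemma infinite_nonempty u :
  (forall N, exists n, N <= size (flatten (mkseq u n))) <-> infinite (fun i => u i != [::]).
Proof.
split=> h N.
  apply: contrapT => hN.
  have nil i : N <= i -> u i = [::].
    by move=> Ni; apply/eqP/negPn/negP => ui; apply: hN; exists i.
  have const k : size (flatten (mkseq u (N + k))) = size (flatten (mkseq u N)).
    by elim: k => [|k IH]; rewrite ?addn0 // addnS flatten_mkseqS size_cat IH nil ?leq_addr ?addn0.
  have [n hn] := h (size (flatten (mkseq u N))).+1.
  have := leq_size_flatten u (leq_addl N n); rewrite const; lia.
elim: N => [|N [n hn]]; first by exists 0.
have [i ni ui] := h n; exists i.+1; rewrite flatten_mkseqS size_cat.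
by have := leq_size_flatten u ni; move: ui; case: (u i) => //= *; lia.
Qed.

End ConcatIs.

(** * Continuity on words with infinitely many occurrences of a group word *)

Lemma continuous_on_inf_occ (X Y : finType) (T : buchi2 X Y) (f : omega X -> omega Y)
    (B : nat) (z : seq X) (G : set (omega X)) :
  (forall t : t_state T * seq X * seq Y * t_state T, t \in t_trans T -> size (inp t) <= B) ->
  fun_graph f = buchi2_rel T ->
  group_word (@lcomp _ _) (phi T B) z ->
  (forall w, G w -> inf_occ z w) ->
  {within G, continuous f}%classic.
Proof.
move=> hB fT zg Gz; apply/subspace_continuousP => w Gw U /nbhs_cyl[n nU].
have : buchi2_rel T (w, f w) by rewrite -fT.
case=> c [[c0 cT cc] [q qF hq] cin /= cout].
(* The first [i] transitions have already produced [n] output letters and have read [P] input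
   letters. *)
have [i hi] := cout.2 n.
set P := size (flatten (mkseq (fun i => inp (c i)) i)).
pose J : {set option (t_state T)} := [set None; Some q]%SET.
have outinf := (infinite_nonempty _).1 cout.2.
have acc : accepts_from (src (c i)) (shift w P) J.
  exists (fun k => c (i + k)); split.
  - by rewrite addn0.
  - by move=> k; apply: cT.
  - by move=> k; rewrite addnS.
  - exact: concat_is_tail cin.
  - move=> j; rewrite finset.inE => /orP[]; rewrite finset.inE => /eqP -> N.
      have [m hm om] := outinf (i + N); exists (m - i); first by lia.
      by rewrite /flag subnKC //; lia.
    have [m hm om] := hq (i + N); exists (m - i); first by lia.
    by rewrite /flag subnKC; [exact/eqP | lia].
have wz := inf_occ_shift P (Gz w Gw); have [a _ wa] := wz 0.
(* The cylinder reaches to the end of an occurrence of [z] behind the [P] letters already read. *)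
rewrite /= /fmap /within /=; apply/nbhs_cyl; exists (P + (a + size z)) => x wx Gx.
apply: nU.
have : accepts_from (src (c i)) (shift x P) J.
  apply: (accepts_transfer hB zg wz (inf_occ_shift P (Gz x Gx)) wa _ acc).
  by move=> k hk; rewrite /shift wx //; lia.
case=> c' [c'0 c'T c'c c'in c'J].
(* The old beginning is spliced with a new continuation on [x]. The label [None] makes its output an
   infinite word, which must be [f x] because the relation is the graph of [f]. *)
pose d k := if k < i then c k else c' (k - i).
have di k : d (i + k) = c' k by rewrite /d ltnNge leq_addr /= addKn.
have dpre (Z : Type) (g : _ -> seq Z) :
    flatten (mkseq (fun k => g (d k)) i) = flatten (mkseq (fun k => g (c k)) i).
  congr flatten; apply/eq_in_map => k; rewrite mem_iota /d => /andP[_ ->] //.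
have dout : infinite (fun k => out (d k) != [::]).
  move=> N; have [|k kN hk] := c'J None _ N; first by rewrite !finset.inE.
  by exists (i + k); [lia | rewrite di].
have dunb := (infinite_nonempty _).2 dout.
have [y hy] := infinite_concat dunb.
have xy : buchi2_rel T (x, y).
  exists d; split=> //.
  - split=> [|k|k].
    + by rewrite /d; case: (posnP i) => [i0|//]; rewrite i0 in c'0 *; rewrite -c0 -c'0.
    + by rewrite /d; case: ifP.
    + have [ki|[ki|ki]] : k.+1 < i \/ i <= k \/ k.+1 = i by lia.
      * by rewrite /d ki ltnW.
      * by rewrite -(subnKC ki) -addnS !di.
      * by rewrite -[in RHS](addn0 k.+1) ki di c'0 /d -ki ltnSn cc.
  - exists q => // N; have [|k kN hk] := c'J (Some q) _ N; first by rewrite !finset.inE eqxx orbT.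
    by exists (i + k); [lia | rewrite di; apply/eqP].
  - apply: (@concat_is_join _ _ _ i); rewrite dpre.
      rewrite (cin.1 i) size_mkseq -/P; apply/eq_in_map => k.
      by rewrite mem_iota => hk; rewrite /= wx //; lia.
    rewrite -/P (_ : (fun k => _) = fun k => inp (c' k)) //.
    by apply/funext => k; rewrite di.
have fx : f x = y by move: xy; rewrite -fT.
suff : cyl (f w) n (f x) by []; rewrite fx => k kn.
have ki : k < size (flatten (mkseq (fun i0 => out (c i0)) i)) by lia.
have := hy i; rewrite dpre {1}(cout.1 i) => /(congr1 (nth (y k) ^~ k)).
by rewrite !nth_mkseq.
Qed.

Section DeterministicBuchi.
Variables (X : finType) (A : dbuchi X).
Implicit Types (w x : omega X).

Fixpoint drun w (i : nat) : d_state A :=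
  if i is j.+1 then d_trans (drun w j) (w j) else d_init A.

Lemma drun_cyl w x n : cyl w n x -> forall i, i <= n -> drun x i = drun w i.
Proof.
by move=> h; elim=> [|i IH] //= ni; rewrite IH ?(ltnW ni) // h.
Qed.

Lemma dbuchi_langE w :
  dbuchi_lang A w <-> infinite (fun i => drun w i \in d_acc A).
Proof.
split=> [[r [r0 rS [q qF h]]]|h].
  have er i : drun w i = r i by elim: i => //= i ->; rewrite rS.
  by move=> N; have [i Ni ri] := h N; exists i; rewrite // er ri.
have [q hq] := infinite_pigeonhole (drun w) h.
exists (drun w); split=> //; exists q.
  by have [i _ [hi <-]] := hq 0.
by move=> N; have [i Ni [_ ri]] := hq N; exists i.
Qed.

(** An accepting visit after time [N] is determined by a finite prefix, hence an open condition;
    acceptance is the intersection over [N]. *)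
Lemma Gdelta_dbuchi : Gdelta (dbuchi_lang A).
Proof.
exists (fun N w => exists2 i, N <= i & drun w i \in d_acc A).
  move=> N; apply: open_cyl => w [i Ni hi]; exists i => x hx; exists i => //.
  by rewrite (drun_cyl hx).
apply/seteqP; split=> w; first by move/dbuchi_langE => h N _.
by move=> h; apply/dbuchi_langE => N; apply: h.
Qed.

Lemma omega_regular_dbuchi : omega_regular (dbuchi_lang A).
Proof.
exists (Buchi (fun q a => [set d_trans q a]%SET) (d_init A) (d_acc A)).
apply/seteqP; split=> w [r [r0 rS ra]]; exists r; split=> // i; move: (rS i);
  by rewrite finset.in_set1 => /eqP.
Qed.

(** [a] is a strategy which reaches acceptance from every state. Following it after an arbitrary
    prefix gives an accepted word in the cylinder. *)
Lemma dense_dbuchi (a : d_state A -> X) :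
  (forall q, exists n, iter n.+1 (fun q => d_trans q (a q)) q \in d_acc A) ->
  dense (dbuchi_lang A).
Proof.
set g := fun q => _; move=> ha O [w Ow] oO.
have [n nO] : exists n, (cyl w n `<=` O)%classic by apply/nbhs_cyl/open_nbhs_nbhs.
pose x : omega X := fun i => if i < n then w i else a (iter (i - n) g (drun w n)).
have wx : cyl w n x by move=> i hi; rewrite /x hi.
have xr k : drun x (n + k) = iter k g (drun w n).
  elim: k => [|k IH]; first by rewrite addn0 (drun_cyl wx).
  by rewrite addnS /= IH /x ltnNge leq_addr /= addKn.
exists x; split; first exact: nO.
apply/dbuchi_langE => N; have [m hm] := ha (iter N g (drun w n)).
by exists (n + (m.+1 + N)); [lia | rewrite xr iterD].
Qed.

End DeterministicBuchi.

(** * Automata waiting for a fixed sequence of letters *)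

Lemma map_rk_enum (X : finType) : map (@rk X) (enum X) = iota 0 #|X|.
Proof.
case: (pickP X) => [x _|X0]; last by rewrite (eq_card0 X0) (eq_enum X0) enum0.
apply: (@eq_from_nth _ 0); first by rewrite size_map size_iota cardE.
move=> i; rewrite size_map -cardE => iX.
rewrite (nth_map x) -?cardE // nth_iota // add0n.
by rewrite -[i]/(val (Ordinal iX)) -enum_val_nth /rk enum_valK.
Qed.

Lemma rk_ord n (i : 'I_n) : rk i = i.
Proof. by rewrite /rk enum_rank_ord. Qed.

Lemma allpairs_iota (h : nat -> nat -> nat) n k :
  [seq h q a | q <- iota 0 n, a <- iota 0 k] = mkseq (fun t => h (t %/ k) (t %% k)) (n * k).
Proof.
elim: n => [|n IH] //.
rewrite -addn1 iotaD map_cat flatten_cat IH mulnDl mul1n /mkseq iotaD map_cat add0n /= cats0.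
congr (_ ++ _); rewrite -[n * k]addn0 (iotaDl (n * k) 0) -map_comp; apply/eq_in_map => j.
rewrite mem_iota => /andP[_ jk] /=.
by rewrite divnMDl ?modnMDl ?(modn_small jk) ?(divn_small jk) ?addn0 //; lia.
Qed.

Section ResetAutomaton.
Variables (X : finType) (d : nat -> nat) (L : nat).
Hypothesis dX : forall j, d j < #|X|.

(* State [j < L] expects a letter of rank [d j]; any other letter, and any
   letter in state [L], leads back to state [0]. *)
Definition reset_automaton : dbuchi X :=
  @DBuchi X 'I_L.+1
    (fun q a => if (rk a == d q) && (q < L) then inord q.+1 else ord0)
    ord0 [set ord_max]%SET.

(** State [j] certifies that the last [j] letters are as expected. An occurrence may be missed,
    since a mismatch discards all progress, but a visit to [L] is always a true one. *)
Lemma drun_reset (w : omega X) i j : drun reset_automaton w i = j :> nat ->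
  j <= i /\ forall k, k < j -> rk (w (i - j + k)) = d k.
Proof.
elim: i j => [|i IH] j /=; first by move=> <-.
case: ifP => [/andP[/eqP h1 h2]|_ <- //].
rewrite inordK // => <-; have [h3 h4] := IH _ erefl; split=> // k.
rewrite ltnS leq_eqVlt subSS => /orP[/eqP ->|/h4 //].
by rewrite subnK.
Qed.

Lemma reset_occ (w : omega X) : dbuchi_lang reset_automaton w ->
  forall N, exists2 n, N <= n & forall k, k < L -> rk (w (n + k)) = d k.
Proof.
move=> /dbuchi_langE h N; have [i Ni] := h (N + L).
rewrite finset.in_set1 => /eqP /(congr1 val) /drun_reset[h1 h2].
by exists (i - L) => //; lia.
Qed.

Lemma dense_reset : dense (dbuchi_lang reset_automaton).
Proof.
pose a (q : 'I_L.+1) : X := enum_val (Ordinal (dX q)).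
apply: (@dense_dbuchi X reset_automaton a) => q.
pose g (p : 'I_L.+1) : 'I_L.+1 := @d_trans X reset_automaton p (a p).
have gE (p : 'I_L.+1) : g p = p.+1 %% L.+1 :> nat.
  rewrite /g /= /rk /a enum_valK eqxx /=; case: ifP => pL.
    by rewrite inordK // modn_small.
  have -> : p = L :> nat by have := ltn_ord p; lia.
  by rewrite modnn.
have itE n (p : 'I_L.+1) : iter n g p = (p + n) %% L.+1 :> nat.
  elim: n => [|n IH]; first by rewrite addn0 modn_small.
  by rewrite iterS gE IH addnS -addn1 modnDml addn1.
(* Expected letters drive the automaton round a cycle of length [L.+1], and [L - q] steps lead from
   [q] to [L]. A full extra turn ensures at least one step when [q = L]. *)
exists (L.+1 + L - q).-1; rewrite finset.in_set1; apply/eqP/val_inj.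
have qL := ltn_ord q.
rewrite [LHS]itE prednK ?subnKC; [|lia|lia].
by rewrite modnDl modn_small.
Qed.

Lemma code_dbuchi_reset : code_dbuchi reset_automaton =
  CodeSeq.code [:: L.+1; #|X|;
    CodeSeq.code (mkseq (fun t => let q := t %/ #|X| in
       ((t %% #|X| == d q) && (q < L)) * q.+1) (L.+1 * #|X|)); 0; CodeSeq.code [:: L]].
Proof.
rewrite /code_dbuchi /code_states /= card_ord.
congr (CodeSeq.code [:: _; _; _; _; _]).
- congr CodeSeq.code.
  rewrite -(allpairs_iota (fun q a => ((a == d q) && (q < L)) * q.+1)).
  rewrite -(map_rk_enum X) -val_enum_ord allpairs_mapl allpairs_mapr.
  congr flatten; apply/eq_map => q; apply/eq_map => a /=.
  rewrite rk_ord; case: ifP => //= /andP[_ qL]; by rewrite inordK // mul1n.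
- by rewrite rk_ord.
- by rewrite enum_set1 /= rk_ord.
Qed.

End ResetAutomaton.

(** * Recursive functions *)

(* [rec_n n F]: F, read as a function of the n entries of its argument list,
   is computable. *)
Definition rec_n (n : nat) (F : seq nat -> nat) : Prop :=
  exists p, forall xs, size xs = n -> computes p xs (F xs).

Lemma rec_n_ext n F G : (forall xs, size xs = n -> F xs = G xs) -> rec_n n F -> rec_n n G.
Proof. by move=> h [p hp]; exists p => xs xn; rewrite -h //; apply: hp. Qed.

Lemma rec_n_proj n i : i < n -> rec_n n (fun xs => nth 0 xs i).
Proof. by move=> ni; exists (RProj i) => xs xn; split; rewrite ?xn. Qed.

Fixpoint all_rec n (Fs : seq (seq nat -> nat)) : Prop :=
  if Fs is F :: Fs' then rec_n n F /\ all_rec n Fs' else True.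

Lemma rec_n_comp n G Fs : rec_n (size Fs) G -> all_rec n Fs ->
  rec_n n (fun xs => G [seq F xs | F : seq nat -> nat <- Fs]).
Proof.
case=> g hg hF.
have [gs hgs] : exists gs, forall xs, size xs = n ->
   (fix all_compute (gs : seq recfun) (ys : seq nat) {struct gs} : Prop :=
     match gs, ys with
     | [::], [::] => True
     | g :: gs', z :: ys' => computes g xs z /\ all_compute gs' ys'
     | _, _ => False
     end) gs [seq F xs | F : seq nat -> nat <- Fs].
  elim: Fs hF {hg} => [|F Fs IH] /=; first by exists [::].
  by case=> -[p hp] /IH[gs hgs]; exists (p :: gs) => xs xn; split; [apply: hp | apply: hgs].
exists (RComp g gs) => xs xn /=; exists [seq F xs | F : seq nat -> nat <- Fs].
  exact: hgs.
by apply: hg; rewrite size_map.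
Qed.

Lemma rec_n_comp1 n (g : seq nat -> nat) F : rec_n 1 g -> rec_n n F ->
  rec_n n (fun xs => g [:: F xs]).
Proof. by move=> h1 h2; apply: (@rec_n_comp n g [:: F]). Qed.

Lemma rec_n_comp2 n (g : seq nat -> nat) F1 F2 : rec_n 2 g -> rec_n n F1 -> rec_n n F2 ->
  rec_n n (fun xs => g [:: F1 xs; F2 xs]).
Proof. by move=> h1 h2 h3; apply: (@rec_n_comp n g [:: F1; F2]). Qed.

Lemma rec_n_succ n F : rec_n n F -> rec_n n (fun xs => (F xs).+1).
Proof.
apply: (@rec_n_comp1 n (fun xs => (nth 0 xs 0).+1)).
by exists RSucc => -[|x [|]] //= _; exists x.
Qed.

Lemma rec_n_const n c : rec_n n (fun=> c).
Proof.
elim: c => [|c]; last exact: rec_n_succ.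
apply: (@rec_n_comp n (fun=> 0) [::]) => //; by exists RZero.
Qed.

Definition projs k n : seq (seq nat -> nat) := [seq (fun xs => nth 0 xs i) | i <- iota k n].

Lemma projs_drop k n xs : size xs = k + n -> [seq F xs | F : seq nat -> nat <- projs k n] = drop k xs.
Proof.
move=> xn; rewrite -map_comp; apply: (@eq_from_nth _ 0).
  by rewrite size_map size_iota size_drop xn addKn.
rewrite size_map size_iota => i iN.
by rewrite (nth_map 0) ?size_iota // nth_iota //= nth_drop.
Qed.

Lemma all_rec_projs k n : all_rec (k + n) (projs k n).
Proof.
rewrite /projs; have : all (fun i => i < k + n) (iota k n).
  by apply/allP => i; rewrite mem_iota => /andP[].
by elim: (iota k n) => //= i s IH /andP[h1 h2]; split; [apply: rec_n_proj | apply: IH].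
Qed.

Lemma rec_n_drop k n F : rec_n n F -> rec_n (k + n) (fun xs => F (drop k xs)).
Proof.
move=> hF; apply: rec_n_ext (@rec_n_comp _ F (projs k n) _ (all_rec_projs k n)) => [xs xn|].
  by rewrite projs_drop.
by rewrite size_map size_iota.
Qed.

(** Used with [k = 2] to evaluate [E] inside a recursion, replacing the counter and the accumulator
    by one index. *)
Lemma rec_n_subst k n E A : rec_n n.+1 E -> rec_n (k + n) A ->
  rec_n (k + n) (fun xs => E (A xs :: drop k xs)).
Proof.
move=> hE hA.
apply: rec_n_ext (@rec_n_comp (k + n) E (A :: projs k n) _ (conj hA (all_rec_projs k n))) => [xs xn|].
  by rewrite /= projs_drop.
by rewrite /= size_map size_iota.
Qed.

Fixpoint prec (a : nat) (g : nat -> nat -> nat) (n : nat) : nat :=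
  if n is m.+1 then g m (prec a g m) else a.

Lemma rec_n_prec n (A G B : seq nat -> nat) : rec_n n A -> rec_n n.+2 G -> rec_n n B ->
  rec_n n (fun xs => prec (A xs) (fun m z => G (m :: z :: xs)) (B xs)).
Proof.
move=> [a ha] [g hg] hB.
pose H xs := prec (A (behead xs)) (fun m z => G (m :: z :: behead xs)) (head 0 xs).
have hH : rec_n n.+1 H.
  exists (RPrec a g) => -[|b xs] //= [xn]; exists b, xs; split=> //.
  rewrite /H /=; elim: b => [|b IH] /=; first exact: ha.
  by exists (prec (A xs) (fun m z => G [:: m, z & xs]) b); rewrite //; apply: hg; rewrite /= xn.
apply: rec_n_ext (@rec_n_comp n H (B :: projs 0 n) _ (conj hB (all_rec_projs 0 n))) => [xs xn|].
  by rewrite /= projs_drop // drop0.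
by rewrite /= size_map size_iota.
Qed.

Section Arithmetic.
Variables (n : nat) (F G : seq nat -> nat).
Hypotheses (hF : rec_n n F) (hG : rec_n n G).

Lemma rec_n_add : rec_n n (fun xs => F xs + G xs).
Proof.
apply: rec_n_ext (rec_n_prec hF (G := fun ys => (nth 0 ys 1).+1) _ hG) => [xs _|] /=.
  by elim: (G xs) => [|k /= ->]; rewrite ?addn0 ?addnS.
by apply/rec_n_succ/rec_n_proj.
Qed.

Lemma rec_n_pred : rec_n n (fun xs => (F xs).-1).
Proof.
apply: rec_n_ext (rec_n_prec (rec_n_const n 0) (G := fun ys => nth 0 ys 0) _ hF) => [xs _|] /=.
  by case: (F xs).
exact: rec_n_proj.
Qed.

End Arithmetic.

Lemma rec_n_sub n F G : rec_n n F -> rec_n n G -> rec_n n (fun xs => F xs - G xs).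
Proof.
move=> hF hG.
apply: rec_n_ext (rec_n_prec hF (G := fun ys => (nth 0 ys 1).-1) _ hG) => [xs _|] /=.
  by elim: (G xs) => [|k /= ->]; rewrite ?subn0 ?subnS.
by apply/rec_n_pred/rec_n_proj.
Qed.

Lemma rec_n_mul n F G : rec_n n F -> rec_n n G -> rec_n n (fun xs => F xs * G xs).
Proof.
apply: (@rec_n_comp2 n (fun xs => nth 0 xs 0 * nth 0 xs 1)).
apply: rec_n_ext (rec_n_prec (rec_n_const 2 0) (G := fun ys => nth 0 ys 1 + nth 0 ys 2) _
  (@rec_n_proj 2 1 isT)) => [xs _|] /=.
  by elim: (nth 0 xs 1) => [|k /= ->]; rewrite ?muln0 ?mulnSr.
by apply: rec_n_add; apply: rec_n_proj.
Qed.

Lemma rec_n_exp n F G : rec_n n F -> rec_n n G -> rec_n n (fun xs => F xs ^ G xs).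
Proof.
apply: (@rec_n_comp2 n (fun xs => nth 0 xs 0 ^ nth 0 xs 1)).
apply: rec_n_ext (rec_n_prec (rec_n_const 2 1) (G := fun ys => nth 0 ys 2 * nth 0 ys 1) _
  (@rec_n_proj 2 1 isT)) => [xs _|] /=.
  by elim: (nth 0 xs 1) => [|k /= ->]; rewrite ?expnS.
by apply: rec_n_mul; apply: rec_n_proj.
Qed.

Lemma rec_n_leq n F G : rec_n n F -> rec_n n G -> rec_n n (fun xs => F xs <= G xs).
Proof.
move=> hF hG; apply: rec_n_ext (rec_n_sub (rec_n_const n 1) (rec_n_sub hF hG)) => xs _.
by rewrite -subn_eq0; case: (F xs - G xs) => // k; rewrite subSS sub0n.
Qed.

Lemma rec_n_eq n F G : rec_n n F -> rec_n n G -> rec_n n (fun xs => F xs == G xs).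
Proof.
move=> hF hG; apply: rec_n_ext (rec_n_mul (rec_n_leq hF hG) (rec_n_leq hG hF)) => xs _.
by rewrite eqn_leq mulnb.
Qed.

(** The quotient counts the [m < x] with [m.+1 * y <= x]; the factor [1 <= y] gives the value 0 for
    division by zero. *)
Lemma rec_n_div n F G : rec_n n F -> rec_n n G -> rec_n n (fun xs => F xs %/ G xs).
Proof.
apply: (@rec_n_comp2 n (fun xs => nth 0 xs 0 %/ nth 0 xs 1)).
apply: rec_n_ext (rec_n_mul (rec_n_leq (rec_n_const 2 1) (@rec_n_proj 2 1 isT))
 (rec_n_prec (rec_n_const 2 0)
  (G := fun ys => nth 0 ys 1 + ((nth 0 ys 0).+1 * nth 0 ys 3 <= nth 0 ys 2)) _
  (@rec_n_proj 2 0 isT))) => [xs _|] /=.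
  set x := nth 0 xs 0; set y := nth 0 xs 1; case: (posnP y) => [->|y0]; first by rewrite divn0.
  rewrite mul1n.
  have -> k : prec 0 (fun m z => z + (m.+1 * y <= x)) k = minn k (x %/ y).
    elim: k => [|k /= ->]; first by rewrite min0n.
    rewrite -leq_divRL //; lia.
  by apply/minn_idPr; apply: leq_div.
apply: rec_n_add; first exact: rec_n_proj.
by apply: rec_n_leq; [apply: rec_n_mul; [apply: rec_n_succ|] |]; apply: rec_n_proj.
Qed.

Lemma rec_n_mod n F G : rec_n n F -> rec_n n G -> rec_n n (fun xs => F xs %% G xs).
Proof.
move=> hF hG.
apply: rec_n_ext (rec_n_sub hF (rec_n_mul (rec_n_div hF hG) hG)) => xs _.
by rewrite {1}(divn_eq (F xs) (G xs)) addKn.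
Qed.

(** The valuation counts the [m < x] such that [2 ^ m.+1] divides [x]; the factor [0 < x] covers
    [x = 0]. *)
Lemma rec_n_logn2 n F : rec_n n F -> rec_n n (fun xs => logn 2 (F xs)).
Proof.
apply: (@rec_n_comp1 n (fun xs => logn 2 (nth 0 xs 0))).
apply: rec_n_ext (rec_n_prec (rec_n_const 1 0)
  (G := fun ys => nth 0 ys 1 + ((0 < nth 0 ys 2) * (nth 0 ys 2 %% 2 ^ (nth 0 ys 0).+1 == 0))) _
  (@rec_n_proj 1 0 isT)) => [xs _|] /=.
  set x := nth 0 xs 0; case: (posnP x) => [->|x0] //.
  have -> k : prec 0 (fun m z => z + 1 * (x %% 2 ^ m.+1 == 0)) k = minn k (logn 2 x).
    elim: k => [|k /= ->]; first by rewrite min0n.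
    by rewrite -/(dvdn _ _) pfactor_dvdn //; lia.
  by apply/minn_idPr; apply: ltnW; apply: ltn_logl.
apply: rec_n_add; first exact: rec_n_proj.
apply: rec_n_mul; first by apply: rec_n_leq; [apply: rec_n_const | apply: rec_n_proj].
apply: rec_n_eq; last exact: rec_n_const.
apply: rec_n_mod; first exact: rec_n_proj.
by apply: rec_n_exp; [apply: rec_n_const | apply/rec_n_succ/rec_n_proj].
Qed.

(** The formula is the value of [CodeSeq.code] on a list with head [F xs] whose tail has code
    [G xs]. *)
Lemma rec_n_code_cons n F G : rec_n n F -> rec_n n G -> 
  rec_n n (fun xs => 2 ^ F xs * (G xs).*2.+1).
Proof.
move=> hF hG; apply: rec_n_mul; first by apply: rec_n_exp => //; apply: rec_n_const.
apply: rec_n_succ; apply: rec_n_ext (rec_n_add hG hG) => xs _; by rewrite addnn.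
Qed.

Lemma rec_n_code_mkseq n B E : rec_n n B -> rec_n n.+1 E ->
  rec_n n (fun xs => CodeSeq.code (mkseq (fun t => E (t :: xs)) (B xs))).
Proof.
move=> hB hE.
(* The list is built from its end, so step [m] prepends the entry of index [B - m.+1]. *)
pose G ys := 2 ^ E (B (drop 2 ys) - (nth 0 ys 0).+1 :: drop 2 ys) * (nth 0 ys 1).*2.+1.
apply: rec_n_ext (rec_n_prec (rec_n_const n 0) (G := G) _ hB) => [xs xn|].
  rewrite /G /= drop0; set b := B xs; set e := fun t => E (t :: xs).
  have h k : k <= b -> prec 0 (fun m z => 2 ^ e (b - m.+1) * z.*2.+1) k
      = CodeSeq.code (map e (iota (b - k) k)).
    elim: k => [|k IH] kb //=; rewrite IH ?(ltnW kb) //.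
    by rewrite (_ : (b - k.+1).+1 = b - k) //; lia.
  by rewrite h // subnn.
apply: rec_n_code_cons; last exact: rec_n_proj.
apply: (@rec_n_subst 2 n E) => //.
by apply: rec_n_sub; [apply: (@rec_n_drop 2) | apply/rec_n_succ/rec_n_proj].
Qed.

Lemma rec_n_and n (F G : seq nat -> bool) :
  rec_n n F -> rec_n n G -> rec_n n (fun xs => F xs && G xs).
Proof. by move=> hF hG; apply: rec_n_ext (rec_n_mul hF hG) => xs _; rewrite mulnb. Qed.

(** * Effective choice of the automaton *)

Section UniversalWord.
Variables (k N : nat).

(* The concatenation of the [N]-digit expansions in base [k], least digit
   first, of [0, 1, ..., k ^ N - 1]. *)
Definition digit j := (j %/ N) %/ k ^ (j %% N) %% k.

Definition value (u : seq nat) := foldr (fun a m => a + k * m) 0 u.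

Hypothesis k0 : 0 < k.

Lemma value_lt u : all (fun a => a < k) u -> value u < k ^ size u.
Proof. by elim: u => //= a u IH /andP[ak /IH h]; rewrite expnS; nia. Qed.

Lemma nth_value u i : all (fun a => a < k) u -> value u %/ k ^ i %% k = nth 0 u i.
Proof.
elim: u i => [|a u IH] i /=; first by rewrite div0n mod0n nth_nil.
case/andP => ak uk; case: i => [|i] /=.
  by rewrite expn0 divn1 mulnC addnC modnMDl modn_small.
by rewrite expnS divnMA mulnC addnC divnMDl // (divn_small ak) addn0 IH.
Qed.

(** The block of the number [value u] starts at [value u * N]. With the least digit first, it is [u]
    padded by zeros on the right. *)
Lemma digit_universal u : 0 < N -> all (fun a => a < k) u -> size u <= N ->
  exists s, forall i, i < size u -> s + i < N * k ^ N /\ digit (s + i) = nth 0 u i.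
Proof.
move=> N0 uk uN; exists (value u * N) => i iu.
have vN : value u < k ^ N.
  by apply: leq_trans (value_lt uk) _; rewrite leq_pexp2l.
split.
  apply: leq_trans (_ : (value u).+1 * N <= _); first by rewrite mulSn; lia.
  by rewrite mulnC leq_mul2l vN orbT.
rewrite /digit modnMDl (modn_small (leq_trans iu uN)).
by rewrite divnMDl // (divn_small (leq_trans iu uN)) addn0 nth_value.
Qed.

Lemma digit_lt j : digit j < k.
Proof. by rewrite ltn_mod. Qed.

End UniversalWord.

Lemma reset_inf_occ (X : finType) N (z : seq X) (w : omega X) : 0 < #|X| -> 0 < N -> size z <= N ->
  dbuchi_lang (reset_automaton X (digit #|X| N) (N * #|X| ^ N)) w -> inf_occ z w.
Proof.
move=> X0 N0 zN hw M.
have zk : all (fun a => a < #|X|) (map (@rk X) z).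
  by apply/allP => _ /mapP[a _ ->]; rewrite /rk.
have [s hs] : exists s, forall i, i < size z -> s + i < N * #|X| ^ N /\
    digit #|X| N (s + i) = nth 0 (map (@rk X) z) i.
  by have := digit_universal X0 N0 zk; rewrite size_map; apply.
have [n nM hn] := reset_occ hw M.
exists (n + s); first by lia.
have x0 : X := w 0.
apply: (@eq_from_nth _ x0); first by rewrite size_seg.
rewrite size_seg => i iz; have [h1 h2] := hs i iz.
rewrite nth_mkseq // -addnA; apply/enum_rank_inj/val_inj.
by rewrite [LHS](hn _ h1) h2 (nth_map x0).
Qed.

(** * Decoding and bounds in terms of the code *)

Lemma code_cons x s : CodeSeq.code (x :: s) = 2 ^ x * (CodeSeq.code s).*2.+1.
Proof. by []. Qed.

(** Lets the code of [T] itself bound every quantity recorded in it. *)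
Lemma mem_code x s : x \in s -> x < CodeSeq.code s.
Proof.
elim: s => //= y s IH; rewrite inE => /orP[/eqP <-|/IH h].
  by have := ltn_expl x (ltnSn 1); nia.
have : 0 < 2 ^ y by rewrite expn_gt0.
by nia.
Qed.

Lemma size_code s : size s <= CodeSeq.code s.
Proof.
elim: s => //= y s IH.
have : 0 < 2 ^ y by rewrite expn_gt0.
by nia.
Qed.

(** A code is a power of 2 times an odd number: the valuation gives the head, and the odd part gives
    the tail. *)
Lemma logn_code x s : logn 2 (CodeSeq.code (x :: s)) = x.
Proof.
rewrite code_cons lognM ?expn_gt0 // pfactorK // lognE /= dvdn2 /= odd_double /=.
by rewrite addn0.
Qed.

Lemma div_code x s : CodeSeq.code (x :: s) %/ 2 ^ x.+1 = CodeSeq.code s.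
Proof.
rewrite code_cons expnSr divnMl ?expn_gt0 //; lia.
Qed.

(** Decodes the second entry of the list coded by [c]. *)
Definition alphabet_size c := logn 2 (c %/ 2 ^ (logn 2 c).+1).

(* Bounds 2 ^ (#|C| * 2 ^ (#|K| + 1) * #|C|), the number of labelled relations,
   where C is the set of pairs of a state in K and a word of length at most c. *)
Definition length_bound c :=
  2 ^ ((c * (c.+1 * c ^ c)) * 2 ^ c.+1 * (c * (c.+1 * c ^ c))).

Lemma card_set_of (T : finType) : #|{set T}| = 2 ^ #|T|.
Proof.
rewrite -[in RHS]cardsT -card_powerset; apply: eq_card => A.
by rewrite finset.powersetE finset.subsetT.
Qed.

Section Bounds.
Variables (X Y : finType) (T : buchi2 X Y).
Let c := code_buchi2 T.

Lemma alphabet_size_code : alphabet_size c = #|X|.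
Proof. by rewrite /alphabet_size /c /code_buchi2 logn_code div_code logn_code. Qed.

Lemma inp_le_code (t : t_state T * seq X * seq Y * t_state T) :
  t \in t_trans T -> size (inp t) <= c.
Proof.
move=> tT.
have h1 : size (inp t) <= code_word (inp t) by rewrite -(size_map (@rk X)) size_code.
pose code_t (t : t_state T * seq X * seq Y * t_state T) :=
  CodeSeq.code [:: rk (src t); code_word (inp t); code_word (out t); rk (tgt t)].
have h2 : code_word (inp t) < code_t t by apply: mem_code; rewrite !inE eqxx orbT.
have h3 : code_t t < CodeSeq.code (map code_t (enum_fset (t_trans T))).
  by apply/mem_code/map_f.
have h4 : CodeSeq.code (map code_t (enum_fset (t_trans T))) < c.
  by apply: mem_code; rewrite !inE eqxx !orbT.
lia.
Qed.

Lemma card_lrel_le :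
  #|{set conf T c * {set option (t_state T)} * conf T c}| <= length_bound c.
Proof.
have hK : #|t_state T| < c by apply: mem_code; rewrite !inE eqxx.
have hX : #|X| < c by apply: mem_code; rewrite !inE eqxx orbT.
have hC : #|conf T c| <= c * (c.+1 * c ^ c).
  rewrite card_prod leq_mul //; first exact: ltnW.
  rewrite card_bseq; apply: leq_trans (_ : \sum_(i < c.+1) c ^ c <= _).
    apply: leq_sum => i _; apply: leq_trans (_ : c ^ i <= _).
      by case: (i : nat) => [|j] //; rewrite leq_exp2r //; lia.
    by rewrite leq_pexp2l ?(leq_ltn_trans _ hX) // -ltnS.
  by rewrite sum_nat_const card_ord.
move: hC; rewrite card_prod => hC.
rewrite card_set_of /length_bound leq_exp2l // !card_prod card_set_of card_option.
by apply: (leq_mul (leq_mul hC _) hC); rewrite leq_exp2l // ltnS ltnW.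
Qed.

End Bounds.

Definition table_entry k N t :=
  ((t %% k == digit k N (t %/ k)) && (t %/ k < N * k ^ N)) * (t %/ k).+1.

(** The code of the reset automaton for [digit k N] over [k] letters, as an arithmetic function of
    [k] and [N]. *)
Definition automaton_code k N :=
  CodeSeq.code [:: (N * k ^ N).+1; k;
    CodeSeq.code (mkseq (table_entry k N) ((N * k ^ N).+1 * k));
    0; CodeSeq.code [:: N * k ^ N]].

Ltac rec_solve := repeat first
  [ apply: rec_n_const | by apply: rec_n_proj | apply: rec_n_and | apply: rec_n_leq
  | apply: rec_n_eq | apply: rec_n_add | apply: rec_n_mul | apply: rec_n_exp
  | apply: rec_n_div | apply: rec_n_mod | apply: rec_n_succ | apply: rec_n_logn2 ].

Lemma rec_alphabet_size n F : rec_n n F -> rec_n n (fun xs => alphabet_size (F xs)).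
Proof.
apply: (@rec_n_comp1 n (fun xs => alphabet_size (nth 0 xs 0))); rewrite /alphabet_size.
by rec_solve.
Qed.

Lemma rec_length_bound n F : rec_n n F -> rec_n n (fun xs => length_bound (F xs)).
Proof.
apply: (@rec_n_comp1 n (fun xs => length_bound (nth 0 xs 0))); rewrite /length_bound.
by rec_solve.
Qed.

Lemma rec_automaton_code n F G : rec_n n F -> rec_n n G ->
  rec_n n (fun xs => automaton_code (F xs) (G xs)).
Proof.
apply: (@rec_n_comp2 n (fun xs => automaton_code (nth 0 xs 0) (nth 0 xs 1))).
have hL : rec_n 2 (fun xs => nth 0 xs 1 * nth 0 xs 0 ^ nth 0 xs 1) by rec_solve.
do 2 (apply: rec_n_code_cons; first by rec_solve).
apply: rec_n_code_cons; last first.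
  apply: rec_n_code_cons; first by rec_solve.
  by do 2 (apply: rec_n_code_cons; last by rec_solve).
apply: (@rec_n_code_mkseq 2 _ (fun ys => table_entry (nth 0 ys 1) (nth 0 ys 2) (nth 0 ys 0))).
  by rec_solve.
rewrite /table_entry /digit; by rec_solve.
Qed.

Local Open Scope classical_set_scope.

Lemma theorem22_effective : exists M : recfun,
     forall (Sigma Gamma : finType) (T : buchi2 Sigma Gamma)
            (f : omega Sigma -> omega Gamma),
       1 < #|Sigma| -> 1 < #|Gamma| -> fun_graph f = buchi2_rel T ->
       exists A : dbuchi Sigma,
         [/\ computes M [:: code_buchi2 T] (code_dbuchi A),
             dense (dbuchi_lang A), Gdelta (dbuchi_lang A)
           & {within dbuchi_lang A, continuous f}].
Proof.
have [M hM] := rec_automaton_code (rec_alphabet_size (@rec_n_proj 1 0 isT))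
  (rec_length_bound (@rec_n_proj 1 0 isT)).
exists M => X Y T f X1 _ fT.
have X0 : 0 < #|X| by apply: ltnW.
set c := code_buchi2 T.
have N0 : 0 < length_bound c by rewrite expn_gt0.
have dX j : digit #|X| (length_bound c) j < #|X| by apply: digit_lt.
exists (reset_automaton X (digit #|X| (length_bound c)) (length_bound c * #|X| ^ length_bound c)).
split.
- by rewrite code_dbuchi_reset -/(automaton_code _ _) -(alphabet_size_code T); apply: (hM [:: c]).
- exact: dense_reset.
- exact: Gdelta_dbuchi.
(* Here [B] is the code [c]. The length of [z] is at most the number of relations, hence at most
   [length_bound c], so [z] occurs in the word awaited by the automaton. *)
have [z zN zg] := short_group_word (@inp_le_code X Y T).
apply: (continuous_on_inf_occ (@inp_le_code X Y T) fT zg) => w.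
by apply: reset_inf_occ => //; apply: leq_trans zN (card_lrel_le T).
Qed.

Theorem theorem22 :
  (forall (Sigma Gamma : finType) (f : omega Sigma -> omega Gamma),
     1 < #|Sigma| -> 1 < #|Gamma| -> omega_rational f ->
     exists G : set (omega Sigma),
       [/\ dense G, omega_regular G, Gdelta G & {within G, continuous f}])
  /\
  (exists M : recfun,
     forall (Sigma Gamma : finType) (T : buchi2 Sigma Gamma)
            (f : omega Sigma -> omega Gamma),
       1 < #|Sigma| -> 1 < #|Gamma| -> fun_graph f = buchi2_rel T ->
       exists A : dbuchi Sigma,
         [/\ computes M [:: code_buchi2 T] (code_dbuchi A),
             dense (dbuchi_lang A), Gdelta (dbuchi_lang A)
           & {within dbuchi_lang A, continuous f}]).
Proof.
have [M hM] := theorem22_effective; split; last by exists M.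
move=> X Y f X1 Y1 [T fT]; have [A [_ dA GA cA]] := hM X Y T f X1 Y1 fT.
by exists (dbuchi_lang A); split=> //; apply: omega_regular_dbuchi.
Qed.
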